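(* Let $R$ be a commutative ring with unit, $A$ a finitely generated $R$-algebra, and $F\colon A\to A$ an endomorphism of $R$-algebras. Let $f$ denote the map induced by $F$ either on $\mathrm{Id}(A)$ or on $\operatorname{Spec}A$, namely $f(\mathfrak A)=F^{-1}(\mathfrak A)$. Then $h_{\mathrm{top}}(f)=0$, where these spaces are endowed with the constructible topology or with the Zariski topology.
   Context: $\mathrm{Id}(A)$ is the set of proper ideals of $A$. Viewing an ideal as its characteristic function, $\mathrm{Id}(A)\subset\{0,1\}^A$ and $\operatorname{Spec}A\subset\mathrm{Id}(A)$; the constructible topology is induced by the product topology, and is generated by sets $\{\mathfrak A: f_1,\dots,f_m\in\mathfrak A,\ g_1,\dots,g_n\notin\mathfrak A\}$. The Zariski topology on $\mathrm{Id}(A)$ is generated by the sets $\{\mathfrak A: g\notin\mathfrak A\}$, $g\in A$ (on $\operatorname{Spec}A$ it is the usual Zariski topology). Topological entropy of a continuous map $g$ of a quasi-compact space is $\sup_{\mathfrak U}\lim_n\frac1n\log N(\mathfrak U\vee g^{-1}\mathfrak U\vee\dots\vee g^{-(n-1)}\mathfrak U)$ over finite open covers, $N$ the minimal subcover size. *)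

(* Defs.v *)
From HB Require Import structures.
From mathcomp Require Import all_boot all_order all_algebra.
From mathcomp Require Import all_classical all_reals.
From mathcomp Require Import ereal topology normedtype sequences exp.
Set Implicit Arguments. Unset Strict Implicit. Unset Printing Implicit Defensive.
Import Order.TTheory GRing.Theory Num.Theory.
Local Open Scope classical_set_scope.
Local Open Scope ring_scope.
Import numFieldNormedType.Exports.

Definition fg_algebra (R : comPzRingType) (A : comAlgType R) : Prop :=
  exists s : seq A, forall S : set A,
    (forall a, a \in s -> S a) -> S 1 ->
    (forall x y, S x -> S y -> S (x + y)) ->
    (forall x y, S x -> S y -> S (x * y)) ->
    (forall (r : R) x, S x -> S (r *: x)) ->
    S = setT.

Definition proper_ideal (A : comPzRingType) (I : set A) : Prop :=
  [/\ I 0, (forall x y, I x -> I y -> I (x + y)),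
      (forall a x, I x -> I (a * x)) & ~ I 1].

Definition prime_ideal (A : comPzRingType) (I : set A) : Prop :=
  proper_ideal I /\ (forall a b, I (a * b) -> I a \/ I b).

Definition IdA (A : comPzRingType) : set (set A) := [set I | proper_ideal I].
Definition SpecA (A : comPzRingType) : set (set A) := [set I | prime_ideal I].

Definition constructible_subbasis (A : Type) : set (set (set A)) :=
  [set U | exists f : A, U = [set I | I f]] `|`
  [set U | exists g : A, U = [set I | ~ I g]].

Definition zariski_subbasis (A : Type) : set (set (set A)) :=
  [set U | exists g : A, U = [set I | ~ I g]].

Definition gen_open (T : Type) (D : set T) (S : set (set T)) (U : set T) : Prop :=
  U `<=` D /\
  forall x, U x -> exists s : seq (set T),
    (forall V, V \in s -> S V) /\
    (let B := D `&` (fun y => forall V, V \in s -> V y) in B x /\ B `<=` U).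

Definition finite_open_cover (T : Type) (D : set T) (S : set (set T))
  (c : seq (set T)) : Prop :=
  (forall U, U \in c -> gen_open D S U) /\
  D `<=` (fun x => exists2 U, U \in c & U x).

(* the cover  c v g^-1 c v ... v g^-(n-1) c  (restricted to D) *)
Definition join_iter (T : Type) (D : set T) (g : T -> T) (c : seq (set T))
  (n : nat) : set (set T) :=
  [set W | exists k : nat -> set T, (forall i, (i < n)%N -> k i \in c) /\
     W = D `&` (fun x => forall i, (i < n)%N -> k i (iter i g x))].

Definition min_subcover (K : realType) (T : Type) (D : set T)
  (C : set (set T)) : K :=
  inf [set (m%:R : K) | m in
        [set m : nat | exists s : seq (set T), size s = m /\
           (forall V, V \in s -> C V) /\
           D `<=` (fun x => exists2 V, V \in s & V x)]].

Definition htop (K : realType) (T : Type) (D : set T) (S : set (set T))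
  (g : T -> T) : \bar K :=
  ereal_sup [set ((lim ((fun n : nat =>
                    (ln (min_subcover K D (join_iter D g c n)) / n%:R : K)) @ \oo))%:E)
            | c in [set c | finite_open_cover D S c]].

Definition induced_map (A : comPzRingType) (F : A -> A) : set A -> set A :=
  fun I => F @^-1` I.

(* Main.v *)
Require Import Defs.
From HB Require Import structures.
From mathcomp Require Import all_boot all_order all_algebra.
From mathcomp Require Import all_classical all_reals.
From mathcomp Require Import zify lra.
From mathcomp Require Import ereal topology normedtype sequences exp.
Import Order.TTheory GRing.Theory Num.Theory.
Import numFieldNormedType.Exports.
Local Open Scope classical_set_scope.
Local Open Scope ring_scope.

(* By compactness a finite open cover is refined by the partition recording which
   elements of a finite set G belong to an ideal, so it suffices to count, for
   each g in G, the patterns {i < n : F^i g in J} over ideals J. Such a pattern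
   is determined by its greedy subset S, the i with F^i g in J that is not in the
   ideal generated by the earlier members. No F^i g with i in S lies in the ideal
   generated by the F^j g with j in S, j < i, a property inherited by initial
   segments and by shifting S down. If these sets S had positive density, a Konig
   argument would produce an infinite one. But all F^i g lie in an F-stable
   subring generated over Z by the generators of A and finitely many coefficients
   from R; it is Noetherian by Hilbert's basis theorem, so no infinite S exists.
   Hence |S| = o(n), and the number of such S is subexponential in n. *)

Set Implicit Arguments.
Unset Strict Implicit.
Unset Printing Implicit Defensive.

(** * Noetherian rings *)

(** Unlike [proper_ideal], this admits the unit ideal, since ideals generated by orbit elements may
    contain 1. *)
Definition is_ideal (A : comPzRingType) (I : set A) : Prop :=
  [/\ I 0, forall x y, I x -> I y -> I (x + y) & forall a x, I x -> I (a * x)].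

Definition ideal_gen (A : comPzRingType) (X : set A) : set A :=
  [set a | forall I, is_ideal I -> X `<=` I -> I a].

Definition noetherian (A : comPzRingType) : Prop :=
  forall I : set A, is_ideal I ->
    exists2 s : seq A, [set` s] `<=` I & I `<=` ideal_gen [set` s].

Definition subring_closed_set (A : pzRingType) (B : set A) : Prop :=
  [/\ B 1, forall x y, B x -> B y -> B (x - y)
    & forall x y, B x -> B y -> B (x * y)].

Section Ideals.
Context {A : comPzRingType}.
Implicit Types (I X Y : set A) (a x y : A).

Lemma is_idealB I x y : is_ideal I -> I x -> I y -> I (x - y).
Proof. by case=> _ ID IM Ix Iy; apply: ID => //; rewrite -mulN1r; apply: IM. Qed.

Lemma is_ideal_gen X : is_ideal (ideal_gen X).
Proof.
split=> [I [] //|x y Xx Xy I idI XI|a x Xx I idI XI].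
  by case: (idI) => _ ID _; apply: ID; [apply: Xx|apply: Xy].
by case: (idI) => _ _; apply; apply: Xx.
Qed.

Lemma sub_ideal_gen X : X `<=` ideal_gen X.
Proof. by move=> x Xx I _; apply. Qed.

Lemma ideal_gen_sub X Y : X `<=` ideal_gen Y -> ideal_gen X `<=` ideal_gen Y.
Proof. by move=> XY a; apply; first exact: is_ideal_gen. Qed.

Lemma ideal_genS X Y : X `<=` Y -> ideal_gen X `<=` ideal_gen Y.
Proof. by move=> XY; apply: ideal_gen_sub; apply: subset_trans XY (@sub_ideal_gen Y). Qed.

Lemma chain_leq (X : nat -> set A) m n :
  (forall i, X i `<=` X i.+1) -> (m <= n)%N -> X m `<=` X n.
Proof.
move=> XS; elim: n => [|n IH]; first by rewrite leqn0 => /eqP->.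
by rewrite leq_eqVlt => /predU1P[->//|/IH] /subset_trans; apply.
Qed.

Lemma chain_bigcup_seq (X : nat -> set A) (s : seq A) :
  (forall i, X i `<=` X i.+1) -> [set` s] `<=` \bigcup_n X n ->
  exists n, [set` s] `<=` X n.
Proof.
move=> XS; elim: s => [|a s IH] sX; first by exists 0%N => x.
have [|n sn] := IH; first by move=> x xs; apply: sX; rewrite /= inE (xs : x \in s) orbT.
have [|m _ am] := sX a; first exact: mem_head.
exists (maxn m n) => x /=; rewrite inE => /predU1P[->|/sn].
  by apply: chain_leq am; rewrite ?leq_maxl.
by apply: chain_leq; rewrite ?leq_maxr.
Qed.

Lemma is_ideal_bigcup (I : nat -> set A) :
  (forall i, is_ideal (I i)) -> (forall i, I i `<=` I i.+1) ->
  is_ideal (\bigcup_n I n).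
Proof.
move=> idI IS; split=> [|x y [m _ xm] [n _ yn]|a x [n _ xn]].
- by exists 0%N => //; case: (idI 0%N).
- exists (maxn m n) => //; have [_ + _] := idI (maxn m n); apply.
    by apply: chain_leq xm; rewrite ?leq_maxl.
  by apply: chain_leq yn; rewrite ?leq_maxr.
- by exists n => //; have [_ _] := idI n; apply.
Qed.

(** The generators of the union, being finitely many, already lie in one member of the chain. *)
Lemma noetherian_chain (I : nat -> set A) : noetherian A ->
  (forall i, is_ideal (I i)) -> (forall i, I i `<=` I i.+1) ->
  exists N, forall n, I n `<=` I N.
Proof.
move=> nA idI IS; have [s sI Is] := nA _ (is_ideal_bigcup idI IS).
have [N sN] := chain_bigcup_seq IS sI.
exists N => n a an; apply: (Is a) => //; by exists n.
Qed.

End Ideals.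

Section IdealPreimage.
Context {A B : comPzRingType} (phi : {rmorphism A -> B}).

Lemma is_ideal_preimage (I : set B) : is_ideal I -> is_ideal (phi @^-1` I).
Proof.
case=> I0 ID IM; split=> [|x y Ix Iy|a x Ix] /=; rewrite ?rmorph0 ?rmorphD ?rmorphM //.
- exact: ID.
- exact: IM.
Qed.

Lemma ideal_gen_image (X : set A) a :
  ideal_gen X a -> ideal_gen (phi @` X) (phi a).
Proof.
move=> Xa I idI XI; apply: (Xa _ (is_ideal_preimage idI)) => x Xx.
by apply: XI; exists x.
Qed.

End IdealPreimage.
Arguments ideal_gen_image {A B} phi [X a].
Arguments is_ideal_preimage {A B} phi [I].

Lemma noetherian_int : noetherian int.
Proof.
move=> I idI; have [I0 ID IM] := idI.
have [nz|allz] := pselect (exists n : nat, (0 < n)%N && `[< I n%:Z >]); last first.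
  exists [::] => // a Ia; suff -> : a = 0 by case: (is_ideal_gen [set` [::] : seq int]).
  apply/eqP/negP => /negP a0; apply: allz; exists `|a|%N.
  rewrite absz_gt0 a0; apply/asboolP.
  by rewrite abszE normrEsg; apply: IM.
case: (ex_minnP nz) => n /andP[n0 /asboolP In] nmin.
exists [:: n%:Z] => [x /=|a Ia]; first by rewrite inE => /eqP->.
have Ir : I (a %% n%:Z)%Z.
  by rewrite /modz; apply: is_idealB => //; apply: IM.
have r0 : (a %% n%:Z)%Z = 0.
  have ge0 : 0 <= (a %% n%:Z)%Z by rewrite modz_ge0 // eqz_nat -lt0n.
  have ltn : (a %% n%:Z)%Z < n%:Z by rewrite ltz_pmod.
  case: (a %% n%:Z)%Z ge0 ltn Ir => // r _ rn Ir.
  case: (posnP r) => [->//|r0]; have /nmin : (0 < r)%N && `[< I r%:Z >].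
    by rewrite r0; apply/asboolP.
  by rewrite leqNgt -ltz_nat rn.
rewrite (divz_eq a n%:Z) r0 addr0.
have [_ _] := is_ideal_gen ([set` [:: n%:Z]] : set int); apply.
by apply: sub_ideal_gen; rewrite /= inE.
Qed.

(** * Hilbert's basis theorem *)

Section HilbertBasis.
Context {R : comNzRingType} (noethR : noetherian R).
Variable (I : set {poly R}).
Hypothesis idI : is_ideal I.

(** A size bound instead of an exact degree keeps 0 in the set and makes it closed under sums. *)
Definition lead_ideal (d : nat) : set R :=
  [set a | exists2 p, I p & (size p <= d.+1)%N /\ p`_d = a].

Lemma is_ideal_lead d : is_ideal (lead_ideal d).
Proof.
have [I0 ID IM] := idI; split.
- by exists 0 => //; rewrite size_poly0 coef0.
- move=> _ _ [p Ip [sp <-]] [q Iq [sq <-]]; exists (p + q); first exact: ID.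
  by rewrite coefD (leq_trans (size_polyD _ _)) // geq_max sp.
- move=> a _ [p Ip [sp <-]]; exists (a%:P * p); first exact: IM.
  by rewrite coefCM mul_polyC (leq_trans (size_scale_leq _ _)).
Qed.

Lemma lead_idealS d : lead_ideal d `<=` lead_ideal d.+1.
Proof.
have [I0 ID IM] := idI.
move=> _ [p Ip [sp <-]]; exists ('X * p); first exact: IM.
by rewrite coefXM /= (leq_trans (size_polyMleq _ _)) // size_polyX.
Qed.

Lemma lead_ideal_lift d : exists2 s : seq {poly R}, [set` s] `<=` I &
  forall a, lead_ideal d a -> exists2 q, I q /\ ideal_gen [set` s] q &
    (size q <= d.+1)%N /\ q`_d = a.
Proof.
have [I0 ID IM] := idI.
have [r rL Lr] := noethR (is_ideal_lead d).
have [s sI rs] : exists2 s : seq {poly R}, [set` s] `<=` I &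
    forall a, a \in r -> exists2 q, q \in s & (size q <= d.+1)%N /\ q`_d = a.
  elim: r rL {Lr} => [|a r IH] rL; first by exists [::].
  have [|s sI rs] := IH; first by move=> x xr; apply: rL; rewrite /= inE (xr : x \in r) orbT.
  have [p Ip pa] := rL a (mem_head _ _).
  exists (p :: s) => [q /=|b]; rewrite inE => /predU1P[->|] //; first exact: sI.
    by exists p; rewrite ?mem_head.
  by move/rs => [q qs qb]; exists q => //; rewrite inE qs orbT.
exists s => // a /Lr ra.
(* The coefficients that lift in this way form an ideal; it contains [r], hence all of
   [lead_ideal d]. *)
apply: (ra [set b | exists2 q, I q /\ ideal_gen [set` s] q &
    (size q <= d.+1)%N /\ q`_d = b]); last first.
  move=> b /rs[q qs qb]; exists q => //; split; first exact: sI.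
  exact: sub_ideal_gen.
have [G0 GD GM] := is_ideal_gen [set` s].
split.
- by exists 0; rewrite ?size_poly0 ?coef0.
- move=> _ _ [p [Ip Gp] [sp <-]] [q [Iq Gq] [sq <-]].
  exists (p + q); first by split; [exact: ID|exact: GD].
  by rewrite coefD (leq_trans (size_polyD _ _)) // geq_max sp.
- move=> b _ [p [Ip Gp] [sp <-]]; exists (b%:P * p).
    by split; [exact: IM|exact: GM].
  by rewrite coefCM mul_polyC (leq_trans (size_scale_leq _ _)).
Qed.

Lemma size_polyB_top (p q : {poly R}) d : (size p <= d.+1)%N ->
  (size q <= d.+1)%N -> q`_d = p`_d -> (size (p - q)%R <= d)%N.
Proof.
move=> /leq_sizeP sp /leq_sizeP sq pq; apply/leq_sizeP => j.
rewrite leq_eqVlt coefB => /predU1P[<-|dj]; first by rewrite pq subrr.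
by rewrite sp // sq // subrr.
Qed.

(** Induction on the size bound: lifted generators of the top coefficients cancel the term of degree
    [d]. *)
Lemma bounded_degree_fg D : exists2 s : seq {poly R}, [set` s] `<=` I &
  forall p, I p -> (size p <= D)%N -> ideal_gen [set` s] p.
Proof.
elim: D => [|d [s sI IH]].
  exists [::] => // p _; rewrite leqn0 size_poly_eq0 => /eqP->.
  by case: (is_ideal_gen [set` [::] : seq {poly R}]).
have [r rI rL] := lead_ideal_lift d.
exists (r ++ s) => [p /=|p Ip sp]; first by rewrite mem_cat => /orP[/rI|/sI].
have [|q [Iq Gq] [sq qp]] := rL p`_d; first by exists p.
have [_ GD _] := is_ideal_gen [set` (r ++ s)].
rewrite -(subrK q p); apply: GD.
  apply: (@ideal_genS _ [set` s]); first by move=> x /= xs; rewrite mem_cat xs orbT.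
  by apply: IH; [exact: is_idealB|exact: size_polyB_top].
by apply: ideal_genS Gq => x /= xs; rewrite mem_cat xs.
Qed.

(** The leading ideals are constant from some degree [D] on. A polynomial of larger degree [d] loses
    its top term on subtracting ['X^(d - D) * q] for some [q] in [I] of degree at most [D], so
    generators for size [D.+1] suffice. *)
Lemma poly_ideal_fg : exists2 s : seq {poly R},
  [set` s] `<=` I & I `<=` ideal_gen [set` s].
Proof.
have [I0 ID IM] := idI.
have [D LD] := noetherian_chain noethR is_ideal_lead lead_idealS.
have [s sI sG] := bounded_degree_fg D.+1.
exists s => // p; have [n] := ubnP (size p); elim: n p => // n IH p sp Ip.
have [/sG|Dp] := leqP (size p) D.+1; first exact.
case def_d: (size p) => [|d]; first by rewrite def_d in Dp.
have dD : (D < d)%N by rewrite def_d in Dp.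
have [|q Iq [sq qp]] := LD d p`_d; first by exists p; rewrite ?def_d.
have [_ GD GM] := is_ideal_gen [set` s].
rewrite -(subrK ('X^(d - D) * q) p); apply: GD; last by apply: GM; exact: sG.
apply: IH; last by apply: is_idealB => //; exact: IM.
rewrite def_d ltnS in sp; apply: leq_trans sp; rewrite ltnS.
apply: size_polyB_top; rewrite ?def_d //.
  apply: leq_trans (size_polyMleq _ _) _; rewrite size_polyXn addSn /=.
  by rewrite (leq_trans (leq_add (leqnn _) sq)) // addnS subnK // ltnW.
by rewrite coefXnM ltnNge leq_subr /= subKn // ltnW.
Qed.

End HilbertBasis.

Lemma noetherian_poly (R : comNzRingType) : noetherian R -> noetherian {poly R}.
Proof. by move=> nR I; apply: poly_ideal_fg. Qed.

(** * Finitely generated subrings *)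

Lemma range_subring (A B : nzRingType) (phi : {rmorphism A -> B}) :
  subring_closed_set (range phi).
Proof.
split; first by exists 1; rewrite ?rmorph1.
- by move=> _ _ [x _ <-] [y _ <-]; exists (x - y); rewrite ?rmorphB.
- by move=> _ _ [x _ <-] [y _ <-]; exists (x * y); rewrite ?rmorphM.
Qed.

Lemma subring_closedE (A : pzRingType) (B : set A) : subring_closed_set B ->
  [/\ B 0, forall x y, B x -> B y -> B (x + y) & forall n : int, B n%:~R].
Proof.
case=> B1 BB BM; have B0 : B 0 by rewrite -(subrr 1); apply: BB.
have BN x : B x -> B (- x) by move=> Bx; rewrite -sub0r; apply: BB.
have BD x y : B x -> B y -> B (x + y).
  by move=> Bx By; rewrite -[y]opprK; apply: BB => //; apply: BN.
split=> // n; have Bn (m : nat) : B m%:R.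
  by elim: m => // m IH; rewrite -addn1 natrD; apply: BD.
by case: n => m; [exact: Bn|rewrite NegzE mulrNz; apply: BN; exact: Bn].
Qed.

(* The image of phi is the subring of A generated by t. *)
Lemma noetherian_fg_subring (A : comNzRingType) (t : seq A) :
  exists (P : comNzRingType) (phi : {rmorphism P -> A}),
    [/\ noetherian P, [set` t] `<=` range phi &
        forall B, subring_closed_set B -> [set` t] `<=` B -> range phi `<=` B].
Proof.
elim: t => [|a t [P [phi [nP tphi phit]]]].
  exists int, intr; split=> //; first exact: noetherian_int.
  by move=> B /subring_closedE[_ _ Bn] _ _ [n _ <-]; exact: Bn.
have cfa : commr_rmorph phi a by move=> x; apply: mulrC.
exists {poly P}, (horner_morph cfa); split; first exact: noetherian_poly.
- move=> x /=; rewrite inE => /predU1P[->|/tphi[p _ <-]].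
    by exists 'X => //; rewrite horner_morphX.
  by exists p%:P => //; rewrite horner_morphC.
- move=> B sB tB _ [p _ <-]; have [B0 BD _] := subring_closedE sB.
  have [_ _ BM] := sB.
  have Ba : B a by apply: tB; exact: mem_head.
  have Bphi : range phi `<=` B.
    by apply: phit => // x xt; apply: tB; rewrite /= inE (xt : x \in t) orbT.
  elim/poly_ind: p => [|p c IH]; first by rewrite rmorph0.
  rewrite rmorphD rmorphM /= horner_morphX horner_morphC.
  by apply: BD; [exact: BM|apply: Bphi; exists c].
Qed.

(** Writing [g] and the images under [F] of the generators [s] takes only finitely many scalars of
    [R]. The subring generated by [s] and these scalars is [F]-stable because [F] fixes every
    [x *: 1]. *)
Lemma fg_algebra_endo_noetherian (R : comPzRingType) (A : comAlgType R)
    (F : {lrmorphism A -> A}) (g : A) : fg_algebra A ->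
  exists (P : comNzRingType) (phi : {rmorphism P -> A}),
    noetherian P /\ forall i, range phi (iter i F g).
Proof.
move=> [s genA].
(* Elements that are integer polynomials in [s] and finitely many scalars form a subalgebra
   containing [s], hence exhaust [A]. *)
have coefs (a : A) : exists r : seq R, forall B, subring_closed_set B ->
    [set` s ++ [seq x *: (1 : A) | x <- r]] `<=` B -> B a.
  pose S : set A := [set b | exists r : seq R, forall B, subring_closed_set B ->
    [set` s ++ [seq x *: (1 : A) | x <- r]] `<=` B -> B b].
  suff ST : S = setT by have : S a by rewrite ST.
  apply: genA.
  - by move=> b bs; exists [::] => B _; apply; rewrite /= mem_cat bs.
  - by exists [::] => B [].
  - move=> x y [r xr] [q yq]; exists (r ++ q) => B sB rqB.
    have [_ BD _] := subring_closedE sB.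
    apply: BD; [apply: xr|apply: yq] => // z /= zin; apply: rqB => /=; move: zin;
      by rewrite map_cat !mem_cat => /orP[]->; rewrite ?orbT.
  - move=> x y [r xr] [q yq]; exists (r ++ q) => B sB rqB.
    have [_ _ BM] := sB.
    apply: BM; [apply: xr|apply: yq] => // z /= zin; apply: rqB => /=; move: zin;
      by rewrite map_cat !mem_cat => /orP[]->; rewrite ?orbT.
  - move=> c x [r xr]; exists (c :: r) => B sB rB.
    have [_ _ BM] := sB; rewrite -[x]mul1r scalerAl; apply: BM.
      by apply: rB; rewrite /= mem_cat mem_head orbT.
    apply: xr => // z /= zin; apply: rB; move: zin; rewrite /= !mem_cat inE.
    by move=> /orP[]->; rewrite ?orbT.
have [r rgs] : exists r : seq R, forall B, subring_closed_set B ->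
    [set` s ++ [seq x *: (1 : A) | x <- r]] `<=` B -> [set` g :: map F s] `<=` B.
  elim: (g :: map F s) => [|a l [r lr]]; first by exists [::].
  have [q aq] := coefs a.
  exists (q ++ r) => B sB qrB x /=; rewrite inE => /predU1P[->|].
    apply: aq => // z /= zin; apply: qrB; move: zin.
    by rewrite /= map_cat !mem_cat => /orP[]->; rewrite ?orbT.
  apply: lr => // z /= zin; apply: qrB; move: zin.
  by rewrite /= map_cat !mem_cat => /orP[]->; rewrite ?orbT.
have [P [phi [nP tphi phit]]] :=
  noetherian_fg_subring (s ++ [seq x *: (1 : A) | x <- r]).
exists P, phi; split=> //.
have sphi := range_subring phi.
have gsphi := rgs _ sphi tphi.
(* Stability is checked on generators, as the preimage of a subring is a subring. *)
have Fphi : range phi `<=` F @^-1` range phi.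
  apply: phit => [|x /=].
    have [p1 pB pM] := sphi; split=> [|x y|x y] /=.
    - by rewrite rmorph1.
    - by rewrite rmorphB; apply: pB.
    - by rewrite rmorphM; apply: pM.
  rewrite mem_cat => /orP[xs|xr].
    by apply: gsphi; rewrite /= inE map_f ?orbT.
  have [c _ xE] := mapP xr; rewrite {1}xE linearZ /= rmorph1 -xE.
  by apply: tphi; rewrite /= mem_cat xr orbT.
elim=> [|i IH]; first by apply: gsphi; exact: mem_head.
exact: Fphi.
Qed.

(** * Density of families of sets of integers *)

(** Konig's lemma for the binary tree: a word is kept as long as it extends to solutions at every
    level. *)
Lemma konig_bool (T : (nat -> bool) -> nat -> Prop) :
  (forall b b' m n, (m <= n)%N -> (forall i, (i < m)%N -> b i = b' i) ->
    T b n -> T b' m) ->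
  (forall n, exists b, T b n) -> exists b, forall n, T b n.
Proof.
move=> Tpre Tn.
pose good (w : seq bool) := forall n, exists2 b, T b n &
  forall i, (i < size w)%N -> b i = nth false w i.
pose w n := iter n (fun v => rcons v `[< good (rcons v true) >]) [::].
have size_w n : size (w n) = n by elim: n => //= n IH; rewrite size_rcons IH.
have good_w n : good (w n).
  elim: n => [n|n IH]; first by have [b] := Tn n; exists b.
  rewrite /w iterS -/(w n); have [//|ngt] := asboolP.
  (* If the extension by [false] fails at level [m], every solution extending [w n] at a level at
     least [m] is [true] at [n], so the extension by [true] is good. *)
  move=> m; apply: contrapT => ngf; apply: ngt => k.
  have [b Tb bw] := IH (maxn m k); exists b; first by apply: Tpre Tb; rewrite ?leq_maxr.
  have bE c : b n = c ->
      forall i, (i < size (rcons (w n) c))%N -> b i = nth false (rcons (w n) c) i.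
    move=> bn i; rewrite size_rcons nth_rcons ltnS leq_eqVlt => /predU1P[->|iw].
      by rewrite ltnn eqxx size_w.
    by rewrite iw; apply: bw.
  case bn: (b n); first exact: bE.
  case: ngf; exists b; last exact: bE.
  by apply: Tpre Tb; rewrite ?leq_maxl.
exists (fun i => nth false (w i.+1) i) => n.
have [b Tb bw] := good_w n n; apply: Tpre Tb => // i ltin.
rewrite bw ?size_w //; elim: n ltin {b bw} => // n IH.
rewrite ltnS leq_eqVlt => /predU1P[->//|ltin].
by rewrite -IH // /w iterS -/(w n) nth_rcons size_w ltin.
Qed.

(* If the density stayed below 1/2q on some window starting at each a, these
   windows would tile [0, n), bounding the overall density by about 1/2q. *)
Lemma dense_start (b : nat -> bool) (q L n : nat) :
  (2 * q * L <= n)%N -> (n < q * count b (iota 0 n))%N ->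
  exists2 a, (a + L <= n)%N &
    forall k, (k <= L)%N -> (k <= 2 * q * count b (iota a k))%N.
Proof.
move=> Ln bn; apply: contrapT => nstart.
have window a : (a + L <= n)%N ->
    exists2 k, (0 < k <= L)%N & (2 * q * count b (iota a k) < k)%N.
  move=> aL; apply: contrapT => nk; apply: nstart; exists a => // k kL.
  rewrite leqNgt; apply/negP => kb; apply: nk; exists k => //.
  by rewrite kL andbT; apply: leq_ltn_trans kb.
(* The hypotheses then give 2n < 2q count <= n + 2qL <= 2n, a contradiction. *)
suff : (2 * q * count b (iota 0 n) <= n + 2 * q * L)%N by lia.
suff H m a : (a + m = n)%N -> (2 * q * count b (iota a m) <= m + 2 * q * L)%N.
  exact: H.
have [l] := ubnP m; elim: l => // l IH in m a *; rewrite ltnS => ml amn.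
(* A final stretch shorter than [L] is bounded by its length, whence the error term. *)
have [Lm|mL] := leqP L m; last first.
  apply: leq_trans (leq_addl _ _); rewrite leq_mul2l; apply/orP; right.
  by apply: leq_trans (count_size _ _) _; rewrite size_iota ltnW.
have [|k /andP[k0 kL] bk] := window a; first by rewrite -amn leq_add2l.
have km : (k <= m)%N by apply: leq_trans Lm.
have := IH (m - k)%N (a + k)%N; rewrite -[in count b (iota a m)](subnKC km) iotaD count_cat.
move=> /(_ ltac:(lia) ltac:(lia)) {IH window nstart}; lia.
Qed.

(** If this failed for [q], [dense_start] would give windows of every length with all prefixes of
    density at least 1/(2q), and [konig_bool] one infinite such sequence, against the finiteness
    hypothesis. *)
Lemma density_zero (Q : (nat -> bool) -> nat -> Prop) :
  (forall b b' m n, (m <= n)%N -> (forall i, (i < m)%N -> b i = b' i) ->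
    Q b n -> Q b' m) ->
  (forall b a n, Q b (a + n)%N -> Q (fun i => b (a + i)%N) n) ->
  (forall b, (forall n, Q b n) -> exists N, forall i, (N <= i)%N -> ~~ b i) ->
  forall q, exists N, forall b n, (N <= n)%N -> Q b n ->
    (q * count b (iota 0 n) <= n)%N.
Proof.
move=> Qpre Qshift Qfin q; apply: contrapT => nN.
pose T b n := Q b n /\ forall k, (k <= n)%N -> (k <= 2 * q * count b (iota 0 k))%N.
have [||b Tb] := @konig_bool T.
- move=> b b' m n mn bb' [Qb dens]; split; first exact: Qpre Qb.
  move=> k km; suff <- : count b (iota 0 k) = count b' (iota 0 k).
    by apply: dens; apply: leq_trans mn.
  apply: eq_in_count => i; rewrite mem_iota /= add0n => ik.
  by apply: bb'; apply: leq_trans km.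
- move=> L; apply: contrapT => nb; apply: nN; exists (2 * q * L)%N => b n Ln Qb.
  rewrite leqNgt; apply/negP => dens; apply: nb.
  have [a aL dens'] := dense_start Ln dens.
  exists (fun i => b (a + i)%N); split.
    by apply: Qshift; apply: Qpre Qb.
  move=> k /dens'; rewrite -[a in iota a k]addn0 iotaDl count_map.
  by move=> H; apply: leq_trans H _; rewrite leq_mul2l; apply/orP; right; apply: sub_count.
have [|N bN] := Qfin b; first by move=> n; case: (Tb n).
have cntN k : (count b (iota 0 (N + k)) <= N)%N.
  rewrite iotaD count_cat add0n (_ : count b (iota N k) = 0%N) ?addn0.
    by apply: leq_trans (count_size _ _) _; rewrite size_iota.
  apply/eqP; rewrite -leqn0 leqNgt -has_count; apply/hasPn => i.
  by rewrite mem_iota => /andP[/bN].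
(* This length exceeds [2 * q * N], whereas the count never exceeds [N]. *)
have [_ /(_ _ (leqnn _))] := Tb (N + (2 * q * N).+1)%N.
move=> H; have := leq_trans H (leq_mul (leqnn _) (cntN _)); lia.
Qed.

(** * Patterns of ideals along an orbit *)

Section IndependentIndices.
Context {A : comPzRingType}.
Implicit Types (x : nat -> A) (b : nat -> bool) (J : set A).

Definition earlier_terms x b i : set A :=
  [set x j | j in [set j | (j < i)%N /\ b j]].

(** Equivalently, the ideals generated by the selected terms grow strictly at each selected index
    below [n]. *)
Definition independent x b n : Prop :=
  forall i, (i < n)%N -> b i -> ~ ideal_gen (earlier_terms x b i) (x i).

Lemma earlier_termsW x b b' i : (forall j, (j < i)%N -> b j -> b' j) ->
  earlier_terms x b i `<=` earlier_terms x b' i.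
Proof. by move=> bb' _ [j [ji bj] <-]; exists j => //; split=> //; apply: bb'. Qed.

Lemma earlier_terms_leq x b i j : (i <= j)%N ->
  earlier_terms x b i `<=` earlier_terms x b j.
Proof. by move=> ij _ [k [ki bk] <-]; exists k => //; split=> //; apply: leq_trans ij. Qed.

Lemma independent_prefix x b b' m n : (m <= n)%N ->
  (forall i, (i < m)%N -> b i = b' i) -> independent x b n -> independent x b' m.
Proof.
move=> mn bb' ind i im; rewrite -bb' // => bi /ideal_genS gen.
apply: (ind i) => //; first exact: leq_trans mn.
by apply: gen; apply: earlier_termsW => j ji; rewrite bb' // (ltn_trans ji).
Qed.

(** The [a]-th iterate of [F] carries a relation among the first [n] terms to one among the terms
    from [a] on. *)
Lemma independent_shift (F : {rmorphism A -> A}) (g : A) b a n :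
  independent (fun i => iter i F g) b (a + n) ->
  independent (fun i => iter i F g) (fun i => b (a + i)%N) n.
Proof.
set x := fun i => iter i F g => ind i lin bi xi.
apply: (ind (a + i)%N) => //; first by rewrite ltn_add2l.
have iter_gen k (X : set A) (c : A) :
    ideal_gen X c -> ideal_gen (iter k F @` X) (iter k F c).
  elim: k => [|k IH] Xc; first by apply: ideal_genS Xc => y Xy; exists y.
  apply: ideal_genS (ideal_gen_image F (IH Xc)) => _ [_ [y Xy <-] <-].
  by exists y.
rewrite /x iterD; apply: ideal_genS (iter_gen a _ _ xi).
move=> _ [_ [j [ji bj] <-] <-]; exists (a + j)%N; last by rewrite /x iterD.
by rewrite /= ltn_add2l.
Qed.


(* The x-pattern of the ideal J on an initial segment is recovered from these
   indices: an index outside is a member exactly when forced by earlier ones. *)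
Definition greedy x J (i : nat) : bool :=
  `[< J (x i) /\
      ~ ideal_gen (earlier_terms x (fun j => `[< J (x j) >]) i) (x i) >].

Lemma greedy_independent x J n : independent x (greedy x J) n.
Proof.
move=> i _ /asboolP[_ nx] /ideal_genS xi; apply: nx; apply: xi.
by apply: earlier_termsW => j _ /asboolP[Jx _]; apply/asboolP.
Qed.

(** By induction, earlier members of [J] lie in the ideal of the greedy terms, so a forced term does
    too. The bound [i.+1] lets [x i] be its own generator when [i] is greedy. *)
Lemma greedy_mem x J i : is_ideal J ->
  J (x i) <-> ideal_gen (earlier_terms x (greedy x J) i.+1) (x i).
Proof.
move=> idJ; split; last first.
  by apply => // _ [j [_ /asboolP[Jx _]] <-].
have [n] := ubnP i; elim: n => // n IH in i *; rewrite ltnS => ltin Jx.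
have [xi|nxi] :=
    pselect (ideal_gen (earlier_terms x (fun j => `[< J (x j) >]) i) (x i)).
  apply: ideal_gen_sub xi => _ [j [ji /asboolP Jj] <-].
  apply: ideal_genS (IH j (leq_trans ji ltin) Jj).
  by apply: earlier_terms_leq; apply: ltnW.
by apply: sub_ideal_gen; exists i => //; split=> //; apply/asboolP.
Qed.

Lemma greedy_inj x J J' n : is_ideal J -> is_ideal J' ->
  (forall i, (i < n)%N -> greedy x J i = greedy x J' i) ->
  forall i, (i < n)%N -> J (x i) <-> J' (x i).
Proof.
move=> idJ idJ' eqJ i ltin.
apply: (iff_trans (greedy_mem x i idJ)).
apply: iff_sym; apply: (iff_trans (greedy_mem x i idJ')).
by split; apply: ideal_genS; apply: earlier_termsW => j;
  rewrite ltnS => ji; rewrite eqJ ?(leq_ltn_trans ji).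
Qed.

End IndependentIndices.

(** The chain of ideals is built from preimages in [P], as [A] itself need not be Noetherian. Once
    it stops growing, a selected index gives a relation in [P], which [phi] carries to a forbidden
    one in [A]. *)
Lemma independent_finite (P A : comPzRingType) (phi : {rmorphism P -> A})
    (x : nat -> A) (b : nat -> bool) :
  noetherian P -> (forall i, range phi (x i)) ->
  (forall n, independent x b n) -> exists N, forall i, (N <= i)%N -> ~~ b i.
Proof.
move=> nP rx ind.
have /choice[p px] : forall i, exists q, phi q = x i.
  by move=> i; have [q _ qx] := rx i; exists q.
have [||N NI] := @noetherian_chain _ (fun n => ideal_gen (earlier_terms p b n)) nP.
- by move=> n; apply: is_ideal_gen.
- by move=> n; apply: ideal_genS; apply: earlier_terms_leq.
exists N => i Ni; apply/negP => bi; apply: (ind i.+1 i) => //.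
have pi : ideal_gen (earlier_terms p b i) (p i).
  apply: (@ideal_genS _ (earlier_terms p b N)); first exact: earlier_terms_leq.
  by apply: (NI i.+1); apply: sub_ideal_gen; exists i.
rewrite -px; apply: ideal_genS (ideal_gen_image phi pi).
by move=> _ [_ [j jb <-] <-]; exists j.
Qed.

Lemma orbit_independent_sparse (R : comPzRingType) (A : comAlgType R)
    (F : {lrmorphism A -> A}) (g : A) (q : nat) : fg_algebra A ->
  exists N, forall b n, (N <= n)%N -> independent (fun i => iter i F g) b n ->
    (q * count b (iota 0 n) <= n)%N.
Proof.
move=> fgA; have [P [phi [nP xphi]]] := fg_algebra_endo_noetherian F g fgA.
apply: (@density_zero (independent (fun i => iter i F g))).
- by move=> b b' m n; apply: independent_prefix.
- by move=> b a n; apply: independent_shift.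
- by move=> b; apply: independent_finite nP xphi.
Qed.

(** * Compactness of the spaces of ideals *)

(** Closedness in the product {0,1}^A, expressed by ultrafilter limits: the final set is the limit
    of the [I t] along [U]. *)
Definition ultra_closed (A : Type) (D : set (set A)) : Prop :=
  forall (T : Type) (U : set_system T), UltraFilter U ->
  forall I : T -> set A, (forall t, D (I t)) -> D [set a | U [set t | I t a]].

Lemma ultra_closed_Id (A : comPzRingType) : ultra_closed (@IdA A).
Proof.
move=> T U ultraU I DI; have PU := @ultra_proper _ _ ultraU.
split=> /=.
- by apply: filterE => t; case: (DI t).
- move=> x y Ux Uy; apply: filterS (filterI Ux Uy) => t [/= Ix Iy].
  by case: (DI t) => _ + _ _; apply.
- move=> a x; apply: filterS => t /=.
  by case: (DI t) => _ _ + _; apply.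
- move=> /filter_ex[t]; by case: (DI t).
Qed.

(** Primality rests on the ultrafilter dichotomy: if the limit omits [a], almost every [I t] omits
    [a], and so contains [b] when it contains [a * b]. *)
Lemma ultra_closed_Spec (A : comPzRingType) : ultra_closed (@SpecA A).
Proof.
move=> T U ultraU I DI; have PU := @ultra_proper _ _ ultraU.
split; first by apply: ultra_closed_Id => // t; case: (DI t).
move=> a b /= Uab.
have [?|Na] := @in_ultra_setVsetC _ U [set t | I t a] ultraU; first by left.
right; apply: filterS (filterI Uab Na) => t [/= Iab nIa].
by have [_ /(_ _ _ Iab)[]] := DI t.
Qed.

(* Compactness: otherwise each finite G has a bad I G in D, and an ultrafilter
   finer than the cofinal filter on finite lists yields a limit of the I G
   lying in some member of c, against badness. *)
Lemma cylinder_refinement (A : eqType) (D : set (set A)) (c : seq (set (set A))) :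
  ultra_closed D -> finite_open_cover D (@constructible_subbasis A) c ->
  exists G : seq A, forall I, D I -> exists2 U, U \in c &
    forall J, D J -> (forall a, a \in G -> I a <-> J a) -> U J.
Proof.
move=> clD [opc covc]; apply: contrapT => nG.
have /choice[I IP] : forall G : seq A, exists I, D I /\ forall U, U \in c ->
    exists2 J, D J /\ (forall a, a \in G -> I a <-> J a) & ~ U J.
  move=> G; apply: contrapT => nI; apply: nG; exists G => I DI; apply: contrapT => nU.
  apply: nI; exists I; split=> // U Uc; apply: contrapT => nJ.
  apply: nU; exists U => // J DJ IJ; apply: contrapT => nUJ.
  by apply: nJ; exists J.
pose cofinal : set_system (seq A) :=
  [set S | exists G : seq A, forall G' : seq A, {subset G <= G'} -> S G'].
have PF : ProperFilter cofinal.
  split; first by move=> [G /(_ G)]; apply.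
  split; first by exists [::].
  - move=> S S' [G GS] [G' GS']; exists (G ++ G') => H GH; split.
      by apply: GS => a aG; apply: GH; rewrite mem_cat aG.
    by apply: GS' => a aG; apply: GH; rewrite mem_cat aG orbT.
  - by move=> S S' SS' [G GS]; exists G => H GH; apply: SS'; apply: GS.
have [U [ultraU FU]] := ultraFilterLemma PF.
have PU := @ultra_proper _ _ ultraU.
have memU a : U [set G | a \in G].
  by apply: FU; exists [:: a] => G; apply; rewrite inE.
pose lim := [set a | U [set G | I G a]].
have Dlim : D lim by apply: clD => // G; case: (IP G).
have [V Vc Vlim] := covc _ Dlim.
have [_ /(_ _ Vlim)[s [sS [[_ slim] sV]]]] := opc V Vc.
(* For such a [G], agreement with [I G] on [G] forces membership in the basic neighbourhood of the
   limit, contrary to the choice of [I G]. *)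
suff /filter_ex[G GV] : U [set G | forall J,
    (forall a, a \in G -> I G a <-> J a) -> forall W, W \in s -> W J].
  have [_ /(_ V Vc)[J [DJ IJ]]] := IP G; apply; apply: sV; split=> // W Ws.
  exact: GV Ws.
elim: s sS slim {sV} => [|W s IH] sS slim; first by apply: filterE.
have Us : U [set G | forall J,
    (forall a, a \in G -> I G a <-> J a) -> forall W, W \in s -> W J].
  by apply: IH => Y Ys; [apply: sS|apply: slim]; rewrite inE Ys orbT.
(* A subbasic set tests one element [a]; almost every [G] contains it, and almost every [I G] agrees
   with the limit there. *)
have UW : U [set G | forall J, (forall a, a \in G -> I G a <-> J a) -> W J].
  have Wlim := slim W (mem_head _ _).
  case: (sS W (mem_head _ _)) Wlim => -[a ->] /= alim.
    by apply: filterS (filterI (memU a) alim) => G [/= aG IGa] J /(_ _ aG) <-.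
  have [//|Na] := @in_ultra_setVsetC _ U [set G | I G a] ultraU.
  by apply: filterS (filterI (memU a) Na) => G [/= aG IGa] J /(_ _ aG) <-.
apply: filterS (filterI Us UW) => G [/= sG WG] J IJ Y.
by rewrite inE => /predU1P[->|]; [apply: WG|apply: sG].
Qed.

(** * Entropy *)

Section SmallSets.
Context {K : realType}.

Lemma sum_expr_card (x : K) n :
  \sum_(S : {set 'I_n}) x ^+ #|S| = (x + 1) ^+ n.
Proof.
have -> : (x + 1) ^+ n = \prod_(i < n) (x + 1) by rewrite prodr_const card_ord.
rewrite bigA_distr; apply: eq_bigr => S _.
by rewrite -big_mkcond /= prodr_const.
Qed.

(* Each set of size at most k contributes at least x ^+ k to sum_expr_card. *)
Lemma card_small_sets (x : K) n k : 0 < x -> x <= 1 ->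
  #|[set S : {set 'I_n} | (#|S| <= k)%N]%SET|%:R * x ^+ k <= (x + 1) ^+ n.
Proof.
move=> x0 x1; rewrite -sum_expr_card mulr_natl -sumr_const.
rewrite big_mkcond /=; apply: ler_sum => S _; rewrite inE.
case: ifP => Sk; last by rewrite exprn_ge0 // ltW.
by apply: ler_wiXn2l => //; exact: ltW.
Qed.

(** With [k] the quotient of [n] by [q], [card_small_sets] bounds the logarithm by
    [n * ln (x + 1) - k * ln x]. The choice of [x] makes the first term at most half of [e * n],
    that of [q] the second. *)
Lemma ln_card_sparse_sets (e : K) : 0 < e -> exists2 q : nat, (0 < q)%N &
  forall n, ln (#|[set S : {set 'I_n} | (q * #|S| <= n)%N]%SET|%:R : K) <= e * n%:R.
Proof.
move=> e0; pose x := Num.min 1 (e / 2).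
have x0 : 0 < x by rewrite lt_min ltr01 divr_gt0.
have x1 : x <= 1 by rewrite ge_min lexx.
have xe : x <= e / 2 by rewrite ge_min lexx orbT.
have lx : 0 <= - ln x by rewrite oppr_ge0 ln_le0.
pose q := (Num.truncn (- ln x / (e / 2))).+1.
have qx : - ln x <= q%:R * (e / 2).
  by rewrite -ler_pdivrMr ?divr_gt0 //; apply/ltW; exact: truncnS_gt.
have q0 : (0 < q)%N by [].
exists q => // n.
set B := [set S : {set 'I_n} | _]%SET.
have BE : B = [set S : {set 'I_n} | (#|S| <= n %/ q)%N]%SET.
  by apply/setP => S; rewrite !inE leq_divRL // mulnC.
have B0 : 0 < (#|B|%:R : K).
  by rewrite ltr0n card_gt0; apply/set0Pn; exists finset.set0; rewrite inE cards0 muln0.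
have := card_small_sets n (n %/ q) x0 x1; rewrite -BE.
rewrite -ler_ln ?posrE ?mulr_gt0 ?exprn_gt0 ?addr_gt0 //.
rewrite lnM ?posrE ?exprn_gt0 // !lnXn ?addr_gt0 //.
rewrite -[ln x *+ _]mulr_natl -[ln (x + 1) *+ _]mulr_natl => H.
have l1 : ln (x + 1) <= e / 2.
  by apply: le_trans xe; rewrite addrC; apply: le_ln1Dx; apply: lt_trans x0; rewrite ltrN10.
have l2 : (n %/ q)%:R * (- ln x) <= n%:R * (e / 2).
  apply: le_trans (ler_wpM2l _ qx) _; first exact: ler0n.
  rewrite (mulrA _ q%:R) -natrM; apply: ler_wpM2r; first by rewrite ltW // divr_gt0.
  by rewrite ler_nat leq_trunc_div.
have l3 : n%:R * ln (x + 1) <= n%:R * (e / 2) by apply: ler_wpM2l; rewrite ?ler0n.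
have -> : e * n%:R = n%:R * (e / 2) + n%:R * (e / 2).
  by rewrite -mulrDr -splitr mulrC.
by rewrite mulrN in l2; lra.
Qed.

End SmallSets.

(** * Minimal subcovers *)

Section MinSubcover.
Context (K : realType) {T : Type}.
Variables (D : set T) (C : set (set T)).

Let sizes : set K := [set (m%:R : K) | m in
  [set m : nat | exists s : seq (set T), size s = m /\
     (forall V, V \in s -> C V) /\
     D `<=` (fun x => exists2 V, V \in s & V x)]].

Lemma min_subcover_has_lbound : has_lbound sizes.
Proof. by exists 0 => _ [m _ <-]; rewrite ler0n. Qed.

Lemma ln_min_subcover_ge0 : 0 <= ln (min_subcover K D C).
Proof.
rewrite -[min_subcover K D C]/(inf sizes).
(* Conventions settle the degenerate cases: [ln] vanishes at nonpositive reals, and the infimum of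
   the empty set is 0. *)
have [s0|n0] := pselect (sizes 0).
  by rewrite ln0 //; apply: ge_inf => //; exact: min_subcover_has_lbound.
have [->|/set0P ne] := eqVneq sizes set0; first by rewrite inf0 ln0.
apply: ln_ge0; apply: lb_le_inf => //.
by move=> _ [[|m] sm <-]; [case: n0; exists 0%N|rewrite ler1n].
Qed.

(** One member of [C] is kept for each value of [code] attained on [D]. *)
Lemma min_subcover_le_card (Q : finType) (B : {set Q}) (code : T -> Q) :
  (forall x, D x -> code x \in B) ->
  (forall x, D x -> exists2 W, C W &
     forall y, D y -> code y = code x -> W y) ->
  min_subcover K D C <= #|B|%:R.
Proof.
move=> codeB DW.
have [s sl [sC Ds]] : exists2 s : seq (set T), (size s <= size (enum B))%N &
    (forall V, V \in s -> C V) /\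
    forall x, D x -> code x \in enum B -> exists2 V, V \in s & V x.
  elim: (enum B) => [|q l [s sl [sC sx]]]; first by exists [::].
  have [[x [Dx xq]]|nx] := pselect (exists x, D x /\ code x = q); last first.
    exists s; first exact: leqW.
    split=> // y Dy; rewrite inE => /predU1P[yq|]; last exact: sx.
    by case: nx; exists y.
  have [W CW Wy] := DW x Dx; exists (W :: s); first by rewrite /= ltnS.
  split=> [V|y Dy]; rewrite inE => /predU1P[|].
  - by move->.
  - exact: sC.
  - by move=> yq; exists W; rewrite ?mem_head //; apply: Wy => //; rewrite yq.
  - by move=> /(sx y Dy)[V Vs Vy]; exists V; rewrite // inE Vs orbT.
apply: (@le_trans _ _ (size s)%:R); last by rewrite ler_nat cardE.
apply: ge_inf; first exact: min_subcover_has_lbound.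
exists (size s) => //; exists s; split=> //; split=> // x Dx.
by apply: Ds => //; rewrite mem_enum codeB.
Qed.

End MinSubcover.

(** * Vanishing of the entropy *)

Section Entropy.
Context (K : realType) {R : comPzRingType} {A : comAlgType R}.
Variable (F : {lrmorphism A -> A}).
Hypothesis fgA : fg_algebra A.
Variable (D : set (set A)).
Hypotheses (idD : forall I, D I -> is_ideal I) (clD : ultra_closed D).
Hypothesis FD : forall I, D I -> D (induced_map F I).

Lemma iter_induced_map n (I : set A) a :
  iter n (induced_map F) I a = I (iter n F a).
Proof. by elim: n a => //= n IH a; rewrite /induced_map /= IH -iterSr. Qed.

Lemma iter_induced_mapD n (I : set A) : D I -> D (iter n (induced_map F) I).
Proof. by move=> DI; elim: n => //= n; apply: FD. Qed.

Definition greedy_set (g : A) (n : nat) (I : set A) : {set 'I_n} :=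
  [set i : 'I_n | greedy (fun i => iter i F g) I i]%SET.

Lemma card_greedy_set g n I :
  #|greedy_set g n I| = count (greedy (fun i => iter i F g) I) (iota 0 n).
Proof.
rewrite -sum1_card -sum1_count -[X in iota 0 X]subn0 big_mkord.
by apply: eq_bigl => i; rewrite inE.
Qed.

(** The greedy sets of [I], one for each element of a finite list, determine the traces on that list
    of the first [n] iterates of [I], hence a member of the join. The exponent is fixed before [q],
    so it costs only a constant factor in the logarithm. *)
Lemma min_subcover_join_le (c : seq (set (set A))) :
  finite_open_cover D (@constructible_subbasis A) c ->
  exists G : nat, forall q, exists N : nat, forall n, (N <= n)%N ->
  min_subcover K D (join_iter D (induced_map F) c n) <=
    #|[set S : {set 'I_n} | (q * #|S| <= n)%N]%SET|%:R ^+ G.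
Proof.
move=> cov; have [G GU] := cylinder_refinement clD cov.
exists (size G) => q.
have [N sparse] : exists N, forall n g I, (N <= n)%N -> g \in G ->
    (q * #|greedy_set g n I| <= n)%N.
  elim: (G) => [|g l [N IH]]; first by exists 0%N.
  have [M gM] := orbit_independent_sparse F g q fgA.
  exists (maxn M N) => n h I; rewrite geq_max inE => /andP[Mn Nn] /predU1P[->|hl].
    by rewrite card_greedy_set; apply: gM => //; exact: greedy_independent.
  exact: IH.
exists N => n Nn.
set S := [set S : {set 'I_n} | _]%SET.
pose code (I : set A) := [ffun i : 'I_(size G) => greedy_set (tnth (in_tuple G) i) n I].
pose B := [set f in ffun_on (mem S)]%SET : {set {ffun 'I_(size G) -> {set 'I_n}}}.
have -> : (#|S|%:R ^+ size G : K) = #|B|%:R.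
  have -> : #|B| = (#|S| ^ size G)%N by rewrite /B cardsE card_ffun_on card_ord.
  by rewrite natrX.
apply: (@min_subcover_le_card _ _ _ _ _ _ code) => I DI.
  rewrite inE; apply/ffun_onP => i; rewrite ffunE inE; apply: sparse => //.
  exact: mem_tnth.
(* A member of the cover is chosen at each step of the orbit of [I]; the resulting join member
   contains every [J] with the same code. *)
have /choice[k kP] : forall i, exists U, U \in c /\ forall J, D J ->
    (forall a, a \in G -> iter i (induced_map F) I a <-> J a) -> U J.
  by move=> i; have [U Uc UP] := GU _ (iter_induced_mapD i DI); exists U.
exists (D `&` (fun J => forall i, (i < n)%N -> k i (iter i (induced_map F) J))).
  by exists k; split=> // i _; case: (kP i).
move=> J DJ JI; split=> // i ltin; have [_ ki] := kP i.
apply: ki => [|a aG]; first exact: iter_induced_mapD.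
rewrite !iter_induced_map.
apply: (greedy_inj (x := fun i => iter i F a) (n := n)) => //; try exact: idD.
move=> j ltjn; have aGs : (index a G < size G)%N by rewrite index_mem.
have gJI : greedy_set a n J = greedy_set a n I.
  by move/ffunP/(_ (Ordinal aGs)): JI; rewrite !ffunE (tnth_nth a) /= nth_index.
by have := congr1 (fun X : {set 'I_n} => Ordinal ltjn \in X) gJI; rewrite !inE.
Qed.

Lemma entropy_of_cover (c : seq (set (set A))) :
  finite_open_cover D (@constructible_subbasis A) c ->
  (fun n : nat => ln (min_subcover K D (join_iter D (induced_map F) c n)) / n%:R : K)
    @ \oo --> (0 : K).
Proof.
move=> cov; have [G GN] := min_subcover_join_le cov.
(* Dividing by [G.+1] absorbs the exponent and stays meaningful when [G] is 0. *)
apply/cvgrPdist_le => e e0; pose e' := e / G.+1%:R.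
have e'0 : 0 < e' by rewrite divr_gt0.
have [q _ lnq] := ln_card_sparse_sets e'0.
have [N HN] := GN q; exists N => // n /= Nn.
have := HN n Nn; have := lnq n; set S := [set S : {set 'I_n} | _]%SET.
set C := join_iter _ _ _ _ => lnS MS.
have lnM0 := ln_min_subcover_ge0 K D C.
have S1 : 1 <= (#|S|%:R : K).
  by rewrite ler1n card_gt0; apply/set0Pn; exists finset.set0; rewrite inE cards0 muln0.
rewrite sub0r normrN ger0_norm ?divr_ge0 ?ler0n //.
have [->|n0] := posnP n; first by rewrite invr0 mulr0 ltW.
rewrite ler_pdivrMr ?ltr0n //.
have lnM : ln (min_subcover K D C) <= ln (#|S|%:R : K) *+ G.
  have [M0|M0] := ltP 0 (min_subcover K D C); last by rewrite ln0 // mulrn_wge0 // ln_ge0.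
  rewrite -lnXn ?(lt_le_trans ltr01) // ler_ln // posrE exprn_gt0 //.
  exact: lt_le_trans ltr01 S1.
apply: (le_trans lnM); apply: (@le_trans _ _ ((e' * n%:R) *+ G)).
  by rewrite lerMn2r lnS orbT.
rewrite -mulr_natl mulrA; apply: ler_wpM2r; first exact: ler0n.
by rewrite /e' mulrCA ger_pMr // ler_pdivrMr // mul1r ler_nat.
Qed.

(** A cover open for a coarser topology is also open for the constructible one, so one estimate
    serves both topologies. *)
Lemma htop_induced_map (B : set (set (set A))) :
  B `<=` @constructible_subbasis A -> htop K D B (induced_map F) = 0%E.
Proof.
move=> BS; rewrite /htop -[RHS](ereal_sup1 0%E); congr ereal_sup.
have cov0 c : finite_open_cover D B c ->
    lim ((fun n : nat => ln (min_subcover K D (join_iter D (induced_map F) c n))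
      / n%:R : K) @ \oo) = 0.
  move=> [opc cov]; apply: cvg_lim => //; apply: entropy_of_cover; split=> //.
  move=> U /opc[UD UB]; split=> // x /UB[s [sB sU]]; exists s; split=> // V /sB.
  exact: BS.
apply/seteqP; split=> [_ [c /cov0 c0 <-]|_ ->] /=; first by rewrite c0.
(* The trivial cover makes the family nonempty, so that the supremum is 0 and not [-oo]; [D] is open
   by the empty list of conditions. *)
have covD : finite_open_cover D B [:: D].
  split=> [U|x Dx]; last by exists D; rewrite ?mem_head.
  rewrite inE => /eqP->; split=> // x Dx; exists [::]; split=> //.
by exists [:: D]; rewrite // cov0.
Qed.

End Entropy.

Unset Implicit Arguments.

Theorem theorem4p2 (K : realType) (R : comPzRingType) (A : comAlgType R)
  (F : {lrmorphism A -> A}) :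
  fg_algebra A ->
  let f := induced_map F in
  [/\ htop K (@IdA A) (@constructible_subbasis A) f = 0%E,
      htop K (@IdA A) (@zariski_subbasis A) f = 0%E,
      htop K (@SpecA A) (@constructible_subbasis A) f = 0%E &
      htop K (@SpecA A) (@zariski_subbasis A) f = 0%E].
Proof.
move=> fgA f.
have zar : @zariski_subbasis A `<=` @constructible_subbasis A by move=> U ?; right.
have idI (I : set A) : IdA I -> is_ideal I by case.
have FI (I : set A) : IdA I -> IdA (F @^-1` I).
  move=> pI; have [I0 ID IM] := is_ideal_preimage F (idI _ pI); case: pI => _ _ _ I1.
  by split=> //=; rewrite rmorph1.
have FS (I : set A) : SpecA I -> SpecA (F @^-1` I).
  move=> [pI Iab]; split; first exact: FI.
  by move=> a b /=; rewrite rmorphM; apply: Iab.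
have idS (I : set A) : SpecA I -> is_ideal I by move=> [/idI].
split; apply: htop_induced_map => //;
  by [exact: ultra_closed_Id | exact: ultra_closed_Spec].
Qed.
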